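(* Let $X$ be a bounded commutative BCK-algebra, $M$ an $X$-module, and $(M_n)_{n\in\mathbb{Z}^+}$ a decreasing sequence of submodules of $M$. Then $M$, equipped with the Baig topology $\Im$ admitted by $(M_n)_{n\in\mathbb{Z}^+}$, is a BCK-topological module.
   Context: A BCK-algebra is a set $X$ with a binary operation $*$ and a constant $0$ such that for all $a,b,c\in X$: $((a*b)*(a*c))*(c*b)=0$; $(a*(a*b))*b=0$; $a*a=0$; $0*a=0$; and $a*b=0=b*a$ implies $a=b$. Write $a\le b$ iff $a*b=0$ (a partial order), and $a\wedge b=b*(b*a)$. $X$ is bounded if it has an element $1$ with $a\le 1$ for all $a\in X$, and commutative if $a\wedge b=b\wedge a$ for all $a,b\in X$. For a bounded commutative BCK-algebra $X$, an $X$-module is an abelian group $(M,+)$ with a map $X\times M\to M$, $(a,m)\mapsto am$, such that $(a\wedge b)m=a(bm)$, $a(m_1+m_2)=am_1+am_2$, $0m=0$ and $1m=m$ for all $a,b\in X$, $m,m_1,m_2\in M$. A submodule is a subgroup $N$ of $M$ that is an $X$-module under the same action (i.e. $an\in N$ for $a\in X,n\in N$). A decreasing sequence of submodules of $M$ is a family $(M_n)_{n\in\mathbb{Z}^+}$ of submodules with $M_{n+1}\subseteq M_n$ for all $n$. The Baig topology on $M$ admitted by it is $\Im=\{V\subseteq M : \forall v\in V\ \exists n\in\mathbb{Z}^+ \text{ such that } v+M_n\subseteq V\}$. An $X$-module $M$ with a topology is a BCK-topological module if addition $M\times M\to M$ (with the product topology on $M\times M$) is continuous and scalar multiplication is continuous,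 meaning that for each $x\in X$ the map $M\to M$, $m\mapsto xm$, is continuous. *)

(* Defs.v *)
From HB Require Import structures.
From mathcomp Require Import all_boot all_order all_algebra.
From mathcomp Require Import all_classical topology normedtype.

Set Implicit Arguments.
Unset Strict Implicit.
Unset Printing Implicit Defensive.

Import GRing.Theory.

Local Open Scope classical_set_scope.
Local Open Scope ring_scope.

HB.mixin Record isBCK X := {
  bck_op : X -> X -> X;
  bck_zero : X;
  bck_triangle : forall a b c : X,
    bck_op (bck_op (bck_op a b) (bck_op a c)) (bck_op c b) = bck_zero;
  bck_op_opl : forall a b : X, bck_op (bck_op a (bck_op a b)) b = bck_zero;
  bck_opxx : forall a : X, bck_op a a = bck_zero;
  bck_op0x : forall a : X, bck_op bck_zero a = bck_zero;
  bck_anti : forall a b : X,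
    bck_op a b = bck_zero -> bck_op b a = bck_zero -> a = b
}.

#[short(type="bckType")]
HB.structure Definition BCK := {X of isBCK X}.

Declare Scope bck_scope.
Delimit Scope bck_scope with bck.
Notation "a * b" := (bck_op a b) : bck_scope.
Notation "0" := (@bck_zero _) : bck_scope.

Definition bck_le (X : bckType) (a b : X) : Prop := (a * b = 0)%bck.

Definition bck_meet (X : bckType) (a b : X) : X := (b * (b * a))%bck.

Notation "a <= b" := (bck_le a b) : bck_scope.
Notation "a `&` b" := (bck_meet a b) : bck_scope.

HB.mixin Record BCK_isBounded X & BCK X := {
  bck_one : X;
  bck_lex1 : forall a : X, (a <= bck_one)%bck
}.

#[short(type="boundedBCKType")]
HB.structure Definition BoundedBCK := {X of BCK X & BCK_isBounded X}.

Notation "1" := (@bck_one _) : bck_scope.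

HB.mixin Record BCK_isCommutative X & BCK X := {
  bck_meetC : forall a b : X, (a `&` b = b `&` a)%bck
}.

#[short(type="commutativeBCKType")]
HB.structure Definition CommutativeBCK := {X of BCK X & BCK_isCommutative X}.

#[short(type="bcBCKType")]
HB.structure Definition BoundedCommutativeBCK :=
  {X of BoundedBCK X & CommutativeBCK X}.

HB.mixin Record Zmodule_isBCKModule (X : bcBCKType) M & GRing.Zmodule M := {
  bck_act : X -> M -> M;
  bck_act_meet : forall (a b : X) (m : M),
    bck_act (a `&` b)%bck m = bck_act a (bck_act b m);
  bck_actDr : forall (a : X) (m1 m2 : M),
    bck_act a (m1 + m2) = bck_act a m1 + bck_act a m2;
  bck_act0 : forall m : M, bck_act 0%bck m = 0;
  bck_act1 : forall m : M, bck_act 1%bck m = m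
}.

#[short(type="bckModType")]
HB.structure Definition BCKModule (X : bcBCKType) :=
  {M of GRing.Zmodule M & Zmodule_isBCKModule X M}.

#[short(type="topBCKModType")]
HB.structure Definition TopologizedBCKModule (X : bcBCKType) :=
  {M of BCKModule X M & Topological M}.

(* M * M carries the product topology; the algebra X carries no topology. *)
Definition is_BCK_topological_module (X : bcBCKType) (M : topBCKModType X)
    : Prop :=
  continuous (fun p : M * M => p.1 + p.2) /\
  (forall x : X, continuous (fun m : M => bck_act x m)).

Record is_submodule (X : bcBCKType) (M : bckModType X) (N : set M) : Prop := {
  submodule0 : N 0;
  submoduleD : forall m n : M, N m -> N n -> N (m + n);
  submoduleN : forall n : M, N n -> N (- n);
  submodule_act : forall (a : X) (n : M), N n -> N (bck_act a n)
}.

(* The index set is the positive integers: the value M_ 0 is irrelevant. *)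
Record decreasing_submodules (X : bcBCKType) (M : bckModType X)
    (M_ : nat -> set M) : Prop := {
  decreasing_submodules_sub : forall n, (0 < n)%N -> is_submodule (M_ n);
  decreasing_submodules_decr : forall n, (0 < n)%N -> M_ n.+1 `<=` M_ n
}.

Definition baig_open (X : bcBCKType) (M : bckModType X) (M_ : nat -> set M)
    : set_system M :=
  [set V | forall v, V v ->
     exists2 n, (0 < n)%N & [set v + m | m in M_ n] `<=` V].

Lemma decreasing_submodules_le (X : bcBCKType) (M : bckModType X)
    (M_ : nat -> set M) (hM : decreasing_submodules M_) (m n : nat) :
  (0 < m)%N -> (m <= n)%N -> M_ n `<=` M_ m.
Proof.
move=> m0 /subnK <-; elim: (n - m)%N => [//|k IHk].
apply: subset_trans IHk; rewrite addSn.
by apply: (decreasing_submodules_decr hM); rewrite addn_gt0 m0 orbT.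
Qed.

Lemma baig_openT (X : bcBCKType) (M : bckModType X) (M_ : nat -> set M) :
  baig_open M_ setT.
Proof. by move=> v _; exists 1%N. Qed.

Lemma baig_openI (X : bcBCKType) (M : bckModType X) (M_ : nat -> set M)
    (hM : decreasing_submodules M_) :
  setI_closed (baig_open M_).
Proof.
move=> U V oU oV v [Uv Vv].
have [i i0 iU] := oU v Uv; have [j j0 jV] := oV v Vv.
exists (maxn i j); first by rewrite leq_max i0.
move=> _ [m mij <-]; split.
- apply: iU; exists m => //.
  exact: (decreasing_submodules_le hM i0 (leq_maxl i j)).
- apply: jV; exists m => //.
  exact: (decreasing_submodules_le hM j0 (leq_maxr i j)).
Qed.

Lemma baig_open_bigU (X : bcBCKType) (M : bckModType X) (M_ : nat -> set M)
    (I : Type) (f : I -> set M) :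
  (forall i, baig_open M_ (f i)) -> baig_open M_ (\bigcup_i f i).
Proof.
move=> of_ v [i _ fiv]; have [n n0 nf] := of_ i v fiv.
by exists n => // w /nf fiw; exists i.
Qed.

(* An alias of M carrying the topology whose open sets are baig_open M_. *)
Definition baig_space (X : bcBCKType) (M : bckModType X) (M_ : nat -> set M)
  (hM : decreasing_submodules M_) : Type := M.

HB.instance Definition _ (X : bcBCKType) (M : bckModType X)
    (M_ : nat -> set M) (hM : decreasing_submodules M_) :=
  BCKModule.copy (baig_space hM) M.

HB.instance Definition _ (X : bcBCKType) (M : bckModType X)
    (M_ : nat -> set M) (hM : decreasing_submodules M_) :=
  isOpenTopological.Build (baig_space hM)
    (@baig_openT X M M_) (baig_openI hM) (@baig_open_bigU X M M_).

Lemma baig_space_openE (X : bcBCKType) (M : bckModType X)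
    (M_ : nat -> set M) (hM : decreasing_submodules M_) :
  (open : set_system (baig_space hM)) = baig_open M_.
Proof.
apply/seteqP; split => V.
- rewrite openE => oV v Vv; have [B [oB Bv BV]] := oV v Vv.
  have [n n0 nB] := oB v Bv.
  by exists n => //; apply: subset_trans BV.
- by rewrite openE => oV v Vv; exists V; split.
Qed.

(* Main.v *)
Require Import Defs.
From mathcomp Require Import all_boot all_algebra all_classical topology.

(** The cosets [v + M_n] are a base of neighbourhoods of [v] for the Baig
topology (lemma [baig_nbhsP]): each coset of a subgroup is open, since it is
also the coset of any of its points.  As the sum of two points of [u + M_n] and
[v + M_n] lies in [(u + v) + M_n], and [a] maps [v + M_n] into [a v + M_n],
addition and every scalar multiplication are continuous at each point. *)

Import GRing.Theory.
Local Open Scope classical_set_scope.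
Local Open Scope ring_scope.

(** Closure under addition is what makes the coset open: if [w] lies in
[v + M_n], then so does [w + M_n]. *)
Lemma baig_open_coset (X : bcBCKType) (M : bckModType X) (M_ : nat -> set M)
    (hM : decreasing_submodules M_) (v : M) (n : nat) :
  (0 < n)%N -> baig_open M_ [set v + m | m in M_ n].
Proof.
move=> n0 _ [m Mm <-]; exists n => // _ [k Mk <-].
exists (m + k); last by rewrite addrA.
exact: (submoduleD (decreasing_submodules_sub hM n0)).
Qed.

Lemma baig_nbhsP (X : bcBCKType) (M : bckModType X) (M_ : nat -> set M)
    (hM : decreasing_submodules M_) (v : baig_space hM)
    (A : set (baig_space hM)) :
  nbhs v A <-> exists2 n, (0 < n)%N & [set v + m | m in M_ n] `<=` A.
Proof.
rewrite nbhsE; split=> [[B [oB Bv] BA]|[n n0 nA]].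
- rewrite baig_space_openE in oB.
  have [n n0 nB] := oB v Bv.
  by exists n => //; apply: subset_trans BA.
- exists [set v + m | m in M_ n] => //; split.
  + by rewrite baig_space_openE; exact: baig_open_coset.
  + exists 0; last exact: addr0.
    exact: (submodule0 (decreasing_submodules_sub hM n0)).
Qed.

Theorem mainTheorem1 (X : bcBCKType) (M : bckModType X) (M_ : nat -> set M)
    (hM : decreasing_submodules M_) :
  is_BCK_topological_module (baig_space hM).
Proof.
split=> [[u v] A /baig_nbhsP [n n0 nA]|a v A /baig_nbhsP [n n0 nA]].
- exists ([set u + m | m in M_ n], [set v + m | m in M_ n]).
    by split; apply/baig_nbhsP; exists n.
  move=> [x y] [/= [m Mm um] [k Mk vk]]; apply: nA => /=.
  exists (m + k); last by rewrite -um -vk addrACA.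
  exact: (submoduleD (decreasing_submodules_sub hM n0)).
- apply/baig_nbhsP; exists n => // _ [m Mm <-]; apply: nA => /=.
  exists (bck_act a m); last by rewrite bck_actDr.
  exact: (submodule_act (decreasing_submodules_sub hM n0)).
Qed.
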